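(* Assume $\varepsilon>2M$. For fixed $\alpha_1\in\mathrm{UHP}_1$ and $\alpha_2\in\mathrm{UHP}_2$, $$\mathcal{I}\bigl[I_{+-}^{\varepsilon}\bigr](\alpha_1,\alpha_2)\longrightarrow 0\quad\text{as }|\alpha_2|\to\infty,$$ where $$\mathcal{I}[\Phi]=\left[\frac{K_{-+}(a_1,\alpha_2)}{K_{+-}(\alpha_1,\alpha_2)}\left[\frac{\Phi}{K_{-\circ}}\right]_{+\circ}\right]_{\circ+}.$$
   Context: Contours and half-planes. Let $k>0$. For $j=1,2$, $\mathcal{A}_j$ is an integration contour in the complex $\alpha_j$-plane running from $-\infty$ to $+\infty$, coinciding with the real axis outside a bounded part, where it is indented (passing above $-k$ and below $k$) so as to avoid the singularities of the functions below. $\mathrm{UHP}_j$ denotes the set of points on and above $\mathcal{A}_j$, $\mathrm{LHP}_j$ the set of points on and below $\mathcal{A}_j$; $\mathcal{D}_{++}=\mathrm{UHP}_1\times\mathrm{UHP}_2$, $\mathcal{D}_{+-}=\mathrm{UHP}_1\times\mathrm{LHP}_2$, $\mathcal{D}_{-+}=\mathrm{LHP}_1\times\mathrm{UHP}_2$, $\mathcal{D}_{--}=\mathrm{LHP}_1\times\mathrm{LHP}_2$. The constant $M>0$ is such that $\operatorname{Im}\alpha_1\ge -M$ on $\mathrm{UHP}_1$ and $\operatorname{Im}\alpha_2\le M$ on $\mathrm{LHP}_2$. ''Analytic on'' such a set, which contains its boundary contours, means analytic in a neighbourhood of it. The constant $a_1$, depending on the incident wave, is such that $K_{-+}(a_1,\alpha_2)$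 below is defined ($a_1\in\mathrm{LHP}_1$). Eigenfunction and exponent. Let $\ell_1$ be the first (smallest) eigenvalue of (minus) the Laplace-Beltrami operator on the unit sphere, with spherical coordinates $(\theta,\varphi)$, with Dirichlet condition on the cut $\{\theta=\pi/2,\ \varphi\in[0,\pi/2]\}$; let $f(\theta,\varphi)$ be the associated first eigenfunction, and $\nu=\sqrt{\ell_1+1/4}\approx 0.7967$. Known properties of $f$: $f(\pi/2,\varphi)=0$ for $\varphi\in[0,\pi/2]$; $f(\pi/2,\cdot)$ is smooth with $0<f(\pi/2,\varphi)\le 1$ on $(\pi/2,2\pi)$; $f(\pi/2,\varphi)=\mathcal{O}(\sqrt{\varphi-\pi/2})$ as $\varphi\to\pi/2^+$ and $\mathcal{O}(\sqrt{2\pi-\varphi})$ as $\varphi\to 2\pi^-$, with $f(\pi/2,2\pi-\psi)\sim\beta\sqrt\psi$ as $\psi\to0^+$ for a constant $\beta$; $f(\pi/2,\cdot)$ is strictly decreasing on $[3\pi/2,2\pi]$. The integral. For $(\alpha_1,\alpha_2)\in\mathcal{D}_{+-}$, $$I_{+-}^{\varepsilon}(\alpha_1,\alpha_2)=\int_{\frac{3\pi}{2}}^{2\pi}\frac{f\left(\frac{\pi}{2},\varphi\right)}{\bigl(-i(\alpha_1\cos\varphi+\alpha_2\sin\varphi+i\varepsilon)\bigr)^{\nu+3/2}}\,d\varphi ,$$ with principal values of the powers (the base has positive real part). Kernel factors (known from earlier work). The kernel $K(\alpha_1,\alpha_2)=(k^2-\alpha_1^2-\alpha_2^2)^{-1/2}$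 admits on $\mathcal{A}_1\times\mathcal{A}_2$ a factorisation $K=K_{++}K_{+-}K_{-+}K_{--}$, where each factor $K_{\pm\pm}$ is analytic (and non-vanishing) on the domain $\mathcal{D}_{\pm\pm}$ with the same signs. For fixed $\alpha_1$, $K_{\pm\pm}(\alpha_1,\alpha_2)=\mathcal{O}(|\alpha_2|^{-1/4})$ as $|\alpha_2|\to\infty$ with $(\alpha_1,\alpha_2)\in\mathcal{D}_{\pm\pm}$, and, for $\alpha_1\in\mathrm{UHP}_1$, $K_{-+}(a_1,\alpha_2)/K_{+-}(\alpha_1,\alpha_2)=\mathcal{O}(1)$ as $|\alpha_2|\to\infty$ on $\mathcal{A}_2$. Furthermore $$K_{-\circ}(\alpha_1,\alpha_2)=K_{--}(\alpha_1,\alpha_2)K_{-+}(\alpha_1,\alpha_2)=\frac{1}{\sqrt{\sqrt{k^2-\alpha_2^2}-\alpha_1}} .$$ For $\alpha_2\in\mathcal{A}_2$, the inner root $\sqrt{k^2-\alpha_2^2}$ is the branch continuous along $\mathcal{A}_2$ that equals $k$ at $\alpha_2=0$ and satisfies $\sqrt{k^2-\alpha_2^2}\sim i|\alpha_2|$ as $\alpha_2\to\pm\infty$ along $\mathcal{A}_2$; its value lies strictly above $\mathcal{A}_1$. The outer root $\sqrt{w}$ is the branch with $\arg w\in(-\pi/2,3\pi/2)$, so that, as a function of $\alpha_1$, $K_{-\circ}$ has its branch cut going vertically upwards in $\mathrm{UHP}_1$ from the point $\sqrt{k^2-\alpha_2^2}$. Cauchy brackets. For a generic function $\Phi$, $$[\Phi]_{+\circ}(\alpha_1,\alpha_2)=\frac{1}{2\pi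 i}\int_{\mathcal{A}^b}\frac{\Phi(z,\alpha_2)}{z-\alpha_1}\,dz,\qquad [\Phi]_{\circ+}(\alpha_1,\alpha_2)=\frac{1}{2\pi i}\int_{\mathcal{A}^b}\frac{\Phi(\alpha_1,z)}{z-\alpha_2}\,dz,$$ where $\mathcal{A}^b$ is a contour lying just below $\mathcal{A}_1$ (for $[\cdot]_{+\circ}$) or just below $\mathcal{A}_2$ (for $[\cdot]_{\circ+}$), so that the brackets can be evaluated, and are analytic, on $\mathcal{A}_1$, respectively $\mathcal{A}_2$. *)

(* Defs.v *)
From Stdlib Require Export Reals List.
From Coquelicot Require Export Coquelicot.
Open Scope R_scope.

(** * Complex powers and roots *)

(** Principal argument, in (-PI, PI].  Off the closed negative real axis
    [w / (Cmod w + Re w)] has the half-angle tangent as imaginary part. *)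
Definition Carg (w : C) : R :=
  match Req_dec_T (Im w) 0, Rlt_dec (Re w) 0 with
  | left _, left _ => PI
  | _, _ => 2 * atan (Im w / (Cmod w + Re w))
  end.

(** [r * exp (i * a)] *)
Definition Cpolar (r a : R) : C := (r * cos a, r * sin a).

Definition Cpow_principal (w : C) (p : R) : C :=
  Cpolar (Rpower (Cmod w) p) (p * Carg w).

(** Square root with [arg w] in (-PI/2, 3*PI/2): the branch cut is the negative
    imaginary axis, and [PI / 2 + Carg (- Ci * w)] is that argument of [w]. *)
Definition Csqrt_down (w : C) : C :=
  Cpolar (sqrt (Cmod w)) ((PI / 2 + Carg (- Ci * w)%C) / 2).

(** * Behaviour at infinity *)

Definition Cinfty : (C -> Prop) -> Prop :=
  fun P => exists rho : R, forall z : C, rho < Cmod z -> P z.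

Definition tends_on (D : C -> Prop) (F : C -> C) (l : C) : Prop :=
  filterlim F (within D Cinfty) (locally l).

Definition bigO_on (D : C -> Prop) (F : C -> C) (g : C -> R) : Prop :=
  exists c : R, within D Cinfty (fun z => Cmod (F z) <= c * g z).

(** * Contours and their two sides *)

Definition path_deriv (g : R -> C) (t : R) : C :=
  (Derive (fun x => Re (g x)) t, Derive (fun x => Im (g x)) t).

Definition piecewise_C1 (g : R -> C) : Prop :=
  (forall t, continuous g t) /\
  exists l : list R,
    (forall t, ~ In t l ->
       ex_derive (fun x => Re (g x)) t /\ ex_derive (fun x => Im (g x)) t /\
       continuous (path_deriv g) t) /\
    (forall t, In t l ->
       exists dl dr : C,
         filterlim (path_deriv g) (at_left t) (locally dl) /\
         filterlim (path_deriv g) (at_right t) (locally dr)).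

(** A simple contour from -oo to +oo which outside a bounded part is the
    horizontal line [Im z = height].  Such a curve cuts the plane into exactly
    two components (Jordan), so [upper] and [lower], the sets of points on and
    above, respectively on and below, the contour, are determined by [path]. *)
Record contour := Contour {
  path :> R -> C;
  height : R;
  upper : C -> Prop;
  lower : C -> Prop;
  path_piecewise_C1 : piecewise_C1 path;
  path_injective : forall t t', path t = path t' -> t = t';
  path_ends : exists T : R, forall t, T <= Rabs t -> path t = (t, height);
  upper_closed : closed upper;
  lower_closed : closed lower;
  sides_cover : forall z, upper z \/ lower z;
  sides_meet : forall z, upper z /\ lower z <-> exists t, z = path t;
  sides_far : exists Y : R,
    forall z, (Y < Im z -> upper z) /\ (Im z < - Y -> lower z)
}.

Definition on (A : contour) (z : C) : Prop := exists t, z = A t.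
Definition strictly_above (A : contour) (z : C) : Prop := upper A z /\ ~ lower A z.
Definition strictly_below (A : contour) (z : C) : Prop := lower A z /\ ~ upper A z.

Definition contour_below (B A : contour) : Prop :=
  height B < height A /\
  (forall t, strictly_below A (B t)) /\ (forall t, strictly_above B (A t)).

(** The closed region between [B] and [A], when [contour_below B A]. *)
Definition band (B A : contour) (z : C) : Prop := upper B z /\ lower A z.

Definition contour_integral (A : contour) (F : C -> C) : C :=
  RInt_gen (V := C_R_CompleteNormedModule)
    (fun t => (F (A t) * path_deriv A t)%C)
    (Rbar_locally m_infty) (Rbar_locally p_infty).

(** * Functions of two complex variables *)

(** Complex differentiability (as a function of the pair) on an open set
    containing [D]. *)
Definition analytic_on (D : C -> C -> Prop) (F : C -> C -> C) : Prop :=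
  exists U : C * C -> Prop,
    open U /\ (forall z1 z2, D z1 z2 -> U (z1, z2)) /\
    forall p, U p ->
      ex_filterdiff (K := C_AbsRing)
        (U := prod_NormedModule C_AbsRing C_NormedModule C_NormedModule)
        (V := C_NormedModule)
        (fun q => F (fst q) (snd q)) (locally p).

Definition rect (D1 D2 : C -> Prop) (z1 z2 : C) : Prop := D1 z1 /\ D2 z2.

Definition kernel_factor (D1 D2 : C -> Prop) (F : C -> C -> C) : Prop :=
  analytic_on (rect D1 D2) F /\
  (forall z1 z2, D1 z1 -> D2 z2 -> F z1 z2 <> 0) /\
  (forall z1, D1 z1 ->
     bigO_on D2 (fun z2 => F z1 z2) (fun z2 => Rpower (Cmod z2) (- (1 / 4)))).

(** A continuous branch of [(k^2 - z1^2 - z2^2)^(-1/2)] on [A1 x A2]. *)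
Definition kernel (k : R) (A1 A2 : contour) (K : C -> C -> C) : Prop :=
  (forall t1 t2,
     (K (A1 t1) (A2 t2) ^ 2 * (k ^ 2 - A1 t1 ^ 2 - A2 t2 ^ 2) = 1)%C) /\
  (forall p : R * R,
     continuous (fun q : R * R => K (A1 (fst q)) (A2 (snd q))) p).

(** The inner root [sqrt (k^2 - z^2)], continuous on the band between [B2] and
    [A2].  The half-line from [s z] vertically upwards, which carries the branch
    cut of [z1 |-> 1 / Csqrt_down (s z - z1)], stays strictly above [A1]. *)
Definition inner_root (k : R) (A1 A2 B2 : contour) (s : C -> C) : Prop :=
  (forall z, band B2 A2 z -> (s z ^ 2 = k ^ 2 - z ^ 2)%C) /\
  (forall z, band B2 A2 z ->
     filterlim s (within (band B2 A2) (locally z)) (locally (s z))) /\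
  (on A2 0 /\ s 0 = k) /\
  tends_on (on A2) (fun z => (s z / (Ci * Cmod z))%C) 1 /\
  (forall z (y : R), band B2 A2 z -> 0 <= y -> strictly_above A1 (s z + Ci * y)%C).

(** * The first Dirichlet eigenfunction of the slit sphere *)

Definition R3 := (R * R * R)%type.

Definition norm3 (p : R3) : R :=
  let '(x, y, z) := p in sqrt (x ^ 2 + y ^ 2 + z ^ 2).

(** Extension of a function on the unit sphere, constant along rays. *)
Definition radial_ext (u : R3 -> R) (p : R3) : R :=
  let '(x, y, z) := p in u (x / norm3 p, y / norm3 p, z / norm3 p).

(** The cone over the cut [theta = PI/2, 0 <= phi <= PI/2]. *)
Definition quarter_plane (p : R3) : Prop :=
  let '(x, y, z) := p in 0 <= x /\ 0 <= y /\ z = 0.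

Definition slice (F : R3 -> R) (i : nat) (p : R3) (t : R) : R :=
  let '(x, y, z) := p in
  match i with 0%nat => F (t, y, z) | 1%nat => F (x, t, z) | _ => F (x, y, t) end.

Definition coord (i : nat) (p : R3) : R :=
  let '(x, y, z) := p in
  match i with 0%nat => x | 1%nat => y | _ => z end.

Definition partial (i : nat) (F : R3 -> R) (p : R3) : R :=
  Derive (slice F i p) (coord i p).

Definition C1_on (D : R3 -> Prop) (F : R3 -> R) : Prop :=
  forall i p, D p ->
    ex_derive (slice F i p) (coord i p) /\ continuous (partial i F) p.

Definition C2_on (D : R3 -> Prop) (F : R3 -> R) : Prop :=
  C1_on D F /\ forall i, C1_on D (partial i F).

Definition laplacian (F : R3 -> R) (p : R3) : R :=
  partial 0 (partial 0 F) p + partial 1 (partial 1 F) p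
  + partial 2 (partial 2 F) p.

(** On the unit sphere the Laplace-Beltrami operator applied to [u] is the
    Laplacian of [radial_ext u].  Continuity up to the cut selects the
    finite-energy solutions at its two end points. *)
Definition slit_sphere_eigenfunction (l : R) (u : R3 -> R) : Prop :=
  (forall p, norm3 p <> 0 -> continuous (radial_ext u) p) /\
  C2_on (fun p => ~ quarter_plane p) (radial_ext u) /\
  (forall p, norm3 p = 1 -> quarter_plane p -> u p = 0) /\
  (forall p, norm3 p = 1 -> ~ quarter_plane p ->
     - laplacian (radial_ext u) p = l * u p) /\
  (exists p, norm3 p = 1 /\ u p <> 0).

Definition first_eigenfunction (l1 : R) (u : R3 -> R) : Prop :=
  slit_sphere_eigenfunction l1 u /\
  forall l v, slit_sphere_eigenfunction l v -> l1 <= l.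

Definition spherical (u : R3 -> R) (theta phi : R) : R :=
  u (sin theta * cos phi, sin theta * sin phi, cos theta).

(** Known properties of [g = f (PI/2, .)], including the normalisation
    [0 < g <= 1]. *)
Definition equatorial_trace (g : R -> R) (beta : R) : Prop :=
  (forall phi, 0 <= phi <= PI / 2 -> g phi = 0) /\
  (forall n phi, PI / 2 < phi < 2 * PI -> ex_derive_n g n phi) /\
  (forall phi, PI / 2 < phi < 2 * PI -> 0 < g phi <= 1) /\
  (exists c, at_right (PI / 2)
     (fun phi => Rabs (g phi) <= c * sqrt (phi - PI / 2))) /\
  (exists c, at_left (2 * PI)
     (fun phi => Rabs (g phi) <= c * sqrt (2 * PI - phi))) /\
  filterlim (fun psi => g (2 * PI - psi) / (beta * sqrt psi))
    (at_right 0) (locally 1) /\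
  (forall phi phi', 3 * PI / 2 <= phi -> phi < phi' -> phi' <= 2 * PI ->
     g phi' < g phi).

(** * The integral and the Cauchy brackets *)

Definition I_pm (f : R -> R -> R) (nu eps : R) (z1 z2 : C) : C :=
  RInt (V := C_R_CompleteNormedModule)
    (fun phi : R =>
       (f (PI / 2)%R phi /
        Cpow_principal (- Ci * (z1 * cos phi + z2 * sin phi + Ci * eps))
          (nu + 3 / 2)%R)%C)
    (3 * PI / 2) (2 * PI).

(** [B] is the contour just below the one the bracket refers to. *)
Definition bracket_plus_o (B : contour) (Phi : C -> C -> C) (z1 z2 : C) : C :=
  (/ (2 * PI * Ci) * contour_integral B (fun z => Phi z z2 / (z - z1)))%C.

Definition bracket_o_plus (B : contour) (Phi : C -> C -> C) (z1 z2 : C) : C :=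
  (/ (2 * PI * Ci) * contour_integral B (fun z => Phi z1 z / (z - z2)))%C.

Definition K_mo (Kmp Kmm : C -> C -> C) (z1 z2 : C) : C :=
  (Kmm z1 z2 * Kmp z1 z2)%C.

Definition I_op (B1 B2 : contour) (a1 : C) (Kpm Kmp Kmm Phi : C -> C -> C) :
    C -> C -> C :=
  bracket_o_plus B2 (fun z1 z2 =>
    (Kmp a1 z2 / Kpm z1 z2 *
     bracket_plus_o B1 (fun w1 w2 => Phi w1 w2 / K_mo Kmp Kmm w1 w2) z1 z2)%C).

(* Main.v *)
Require Import Defs.
From Stdlib Require Import Lra Classical.

(** Both Cauchy brackets are estimated by absolute values.  Write [<t>] for [sqrt (1 + t^2)] and
    [q = sqrt (1 + (Re z1)^2 + (Re z2)^2)].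

    The condition [2 M < eps] keeps the real part of the base of the power in
    [I_pm] above [M / 2], so the integrand is at most a constant times
    [<L phi>^(-3/4)], where [L phi = Re z1 cos phi + Re z2 sin phi] is a sinusoid
    of squared amplitude [q^2 - 1].  A sinusoid of large amplitude spends little
    time near its zeros, and therefore [I_pm = O (q^(-3/4))]
    ([oscillation_majorant], [I_pm_decay]).  Dividing by [K_mo] multiplies by
    [sqrt (s z2 - z1) = O (q^(1/2))], which leaves
    [O (q^(-1/4)) = O (<z1>^(-1/8) <z2>^(-1/8))] for real parts [z1], [z2].  With
    the Cauchy kernel [O (<z1>^(-1))] the inner integrand is integrable, and the
    inner bracket is [O (<Re z2>^(-1/8))] along the lower contour
    ([bracket_plus_o_decay]).

    The quotient of kernel factors being bounded there ([quotient_bounded]), the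
    outer bracket is the Cauchy integral, over a contour just below [A2], of a
    function that decays like a power.  Such an integral tends to 0 uniformly in
    the far part of the upper side ([bracket_o_plus_vanishes]): far away the
    upper side lies in [0 <= Im z2] ([upper_far]), hence at a positive distance
    from the contour of integration ([contour_separation]), and a variable of
    integration is either itself large or far from [z2]
    ([convolution_weight]).

    The operators [RInt] and [RInt_gen] are total on functions with values in
    [C], and they take the value 0 where the integral does not exist
    ([iota_empty]).  A bound for the truncated integrals is thus a bound for the
    value in all cases. *)

(** * Bounds for integrals of complex functions *)

Lemma norm_C_R (z : C_R_CompleteNormedModule) :
  norm z = Cmod z.
Proof.
  symmetry; exact (Cmod_norm z).
Qed.

(** The limit operator of the complete space [R] is a supremum in [Rbar], here
    that of the whole line, and [p_infty] is read as the real number 0. *)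
Lemma R_complete_lim_full (F : (R -> Prop) -> Prop) :
  (forall P, F P) -> R_complete_lim F = 0.
Proof.
  intros HF; unfold R_complete_lim.
  rewrite (is_lub_Rbar_unique _ p_infty); [reflexivity|].
  split.
  - intros x _; exact I.
  - intros [r| |] Hr; simpl; auto.
    + specialize (Hr (r + 1) (HF _)); simpl in Hr; lra.
    + exact (Hr 0 (HF _)).
Qed.

Lemma iota_empty (P : C -> Prop) :
  (forall z, ~ P z) -> iota (T := C_R_CompleteNormedModule) P = RtoC 0.
Proof.
  intros HP.
  change (C_complete_lim (fun A : C -> Prop => forall x : C, P x -> A x) = RtoC 0).
  unfold C_complete_lim.
  rewrite !R_complete_lim_full; [reflexivity| |];
    intros Q x Hx; destruct (HP x Hx).
Qed.

(** Where [F] is not integrable its integral is 0, and [0 <= c] since [psi] is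
    nonnegative. *)
Lemma RInt_Cmod_le (F : R -> C) (psi : R -> R) (a b c : R) :
  a <= b -> (forall t, a <= t <= b -> Cmod (F t) <= psi t) ->
  is_RInt psi a b c ->
  Cmod (RInt (V := C_R_CompleteNormedModule) F a b) <= c.
Proof.
  intros Hab HF Hpsi.
  destruct (classic (ex_RInt (V := C_R_CompleteNormedModule) F a b)) as [H|H].
  - rewrite <- norm_C_R.
    apply (norm_RInt_le (V := C_R_CompleteNormedModule) F psi a b); auto.
    + intros t Ht; rewrite norm_C_R; auto.
    + now apply RInt_correct.
  - unfold RInt; rewrite iota_empty.
    + rewrite Cmod_0.
      apply (is_RInt_ge_0 psi a b); auto.
      intros t Ht; apply Rle_trans with (1 := Cmod_ge_0 (F t)), HF; lra.
    + intros z Hz; apply H; now exists z.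
Qed.

(** A bounded primitive of the majorant controls all truncations at once, hence
    their limit if there is one. *)
Lemma RInt_gen_Cmod_le (F : R -> C) (psi Psi : R -> R) (c : R) :
  (forall t, Cmod (F t) <= psi t) ->
  (forall t, is_derive Psi t (psi t)) ->
  (forall t, continuous psi t) ->
  (forall t, Rabs (Psi t) <= c) ->
  Cmod (RInt_gen (V := C_R_CompleteNormedModule) F
          (Rbar_locally m_infty) (Rbar_locally p_infty)) <= 2 * c.
Proof.
  intros HF Hd Hc Hb.
  destruct (classic (ex_RInt_gen (V := C_R_CompleteNormedModule) F
          (Rbar_locally m_infty) (Rbar_locally p_infty))) as [[l Hl]|H].
  - rewrite (is_RInt_gen_unique _ _ Hl).
    apply le_epsilon; intros e He.
    assert (Hball : locally (T := C_R_CompleteNormedModule) l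
              (fun y => Cmod (y - l)%C < e)).
    { apply (locally_le_locally_norm (V := C_R_CompleteNormedModule) l
               (fun y => Cmod (y - l)%C < e)).
      exists (mkposreal e He); intros y Hy.
      rewrite <- norm_C_R; exact Hy. }
    specialize (Hl _ Hball).
    destruct Hl as [Q S [m Hm] [p Hp] HQS].
    pose (a := Rmin (m - 1) 0); pose (b := Rmax (p + 1) 0).
    assert (Ha : a < m) by (unfold a; generalize (Rmin_l (m - 1) 0); lra).
    assert (Hb' : p < b) by (unfold b; generalize (Rmax_l (p + 1) 0); lra).
    assert (Hab : a <= b)
      by (unfold a, b; generalize (Rmin_r (m - 1) 0) (Rmax_r (p + 1) 0); lra).
    destruct (HQS a b (Hm a Ha) (Hp b Hb')) as [y [Hy1 Hy2]].
    simpl in Hy1.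
    assert (Hyb : Cmod y <= Psi b - Psi a).
    { rewrite <- (is_RInt_unique _ _ _ _ Hy1).
      apply (RInt_Cmod_le F psi); auto.
      apply (is_RInt_derive Psi psi); auto. }
    assert (Hbb := Hb b); assert (Hba := Hb a).
    apply Rabs_le_between in Hbb; apply Rabs_le_between in Hba.
    assert (Htri : Cmod l <= Cmod y + Cmod (y - l)%C).
    { replace (Cmod l) with (Cmod (y + - (y - l))%C) by (f_equal; ring).
      rewrite <- (Cmod_opp (y - l)); apply Cmod_triangle. }
    lra.
  - unfold RInt_gen; rewrite iota_empty.
    + rewrite Cmod_0; generalize (Rabs_pos (Psi 0)) (Hb 0); lra.
    + intros z Hz; apply H; now exists z.
Qed.

(** * The weight [sqrt (1 + t^2)] and its powers *)

Lemma Rpower_pos (x p : R) : 0 < Rpower x p.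
Proof. apply exp_pos. Qed.

Lemma Rpower_le_neg (a b p : R) :
  0 < a -> a <= b -> p <= 0 -> Rpower b p <= Rpower a p.
Proof.
  intros Ha Hab Hp.
  replace p with (- - p) by ring.
  rewrite (Rpower_Ropp a), (Rpower_Ropp b).
  apply Rinv_le_contravar; [apply Rpower_pos|].
  apply Rle_Rpower_l; lra.
Qed.

Lemma Rpower_minus_2 (x p : R) :
  0 < x -> Rpower x (p - 2) * x ^ 2 = Rpower x p.
Proof.
  intros Hx.
  rewrite <- (Rpower_pow 2 x Hx), <- Rpower_plus; f_equal; simpl; ring.
Qed.

(** The Japanese bracket: comparable with [1 + Rabs t], but smooth. *)
Definition jap (t : R) : R := sqrt (1 + t ^ 2).

Lemma jap_sq t : jap t ^ 2 = 1 + t ^ 2.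
Proof. unfold jap; rewrite pow2_sqrt; nra. Qed.

Lemma jap_ge_1 t : 1 <= jap t.
Proof. unfold jap; rewrite <- sqrt_1 at 1; apply sqrt_le_1_alt; nra. Qed.

Lemma jap_pos t : 0 < jap t.
Proof. generalize (jap_ge_1 t); lra. Qed.

Lemma Rabs_le_jap t : Rabs t <= jap t.
Proof.
  rewrite <- (Rabs_pos_eq (jap t)) by (generalize (jap_pos t); lra).
  apply Rsqr_le_abs_0; unfold Rsqr; generalize (jap_sq t); nra.
Qed.

Lemma jap_le t c : 0 <= c -> 1 + t ^ 2 <= c ^ 2 -> jap t <= c.
Proof.
  intros Hc H; unfold jap; rewrite <- (sqrt_pow2 c Hc).
  now apply sqrt_le_1_alt.
Qed.

Lemma jap_le_1_Rabs t : jap t <= 1 + Rabs t.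
Proof.
  apply jap_le; [generalize (Rabs_pos t); lra|].
  rewrite <- (pow2_abs t); generalize (Rabs_pos t); nra.
Qed.

Lemma is_derive_Rpower_jap (p t : R) :
  is_derive (fun t => Rpower (jap t) p) t (p * t * Rpower (jap t) (p - 2)).
Proof.
  assert (H : is_derive (fun x : R => Rpower x p) (jap t) (p * Rpower (jap t) (p - 1))).
  { apply is_derive_Reals, derivable_pt_lim_power, jap_pos. }
  assert (Hj : is_derive jap t (t / jap t)).
  { unfold jap; auto_derive; [nra|].
    fold (jap t); replace (1 + t * (t * 1)) with (1 + t ^ 2) by ring; fold (jap t).
    field; generalize (jap_pos t); lra. }
  generalize (is_derive_comp (fun x => Rpower x p) jap t _ _ H Hj).
  intros Hc.
  replace (p * t * Rpower (jap t) (p - 2))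
    with (scal (t / jap t) (p * Rpower (jap t) (p - 1))); [exact Hc|].
  unfold scal; simpl; unfold mult; simpl.
  replace (p - 1) with ((p - 2) + 1) by ring.
  rewrite Rpower_plus, Rpower_1 by apply jap_pos.
  field; generalize (jap_pos t); lra.
Qed.

Lemma continuous_Rpower_jap (p t : R) : continuous (fun t => Rpower (jap t) p) t.
Proof.
  apply (ex_derive_continuous (fun t => Rpower (jap t) p) t).
  eexists; apply is_derive_Rpower_jap.
Qed.

(** The derivative is [1 + p] times the power [p] of [jap t] up to a term that
    decays faster: a substitute for a primitive of that power, which is in
    general not elementary. *)
Definition tjap (p t : R) : R := t * Rpower (jap t) p.
Definition tjap' (p t : R) : R :=
  (1 + p) * Rpower (jap t) p - p * Rpower (jap t) (p - 2).

Lemma is_derive_tjap (p t : R) : is_derive (tjap p) t (tjap' p t).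
Proof.
  unfold tjap, tjap'.
  generalize (is_derive_mult (fun t : R => t) (fun t => Rpower (jap t) p) t _ _
    (is_derive_id t) (is_derive_Rpower_jap p t)); intros H.
  replace ((1 + p) * Rpower (jap t) p - p * Rpower (jap t) (p - 2)) with
    (plus (mult one (Rpower (jap t) p)) (mult t (p * t * Rpower (jap t) (p - 2)))).
  - apply H; intros; unfold mult; simpl; ring.
  - unfold plus, mult, one; simpl.
    rewrite <- (Rpower_minus_2 (jap t) p) by apply jap_pos.
    rewrite jap_sq; ring.
Qed.

Lemma continuous_tjap' (p t : R) : continuous (tjap' p) t.
Proof.
  unfold tjap'.
  apply (continuous_minus (fun t => (1 + p) * Rpower (jap t) p) (fun t => p * Rpower (jap t) (p - 2)));
    apply (continuous_scal_r (V := R_NormedModule)), continuous_Rpower_jap.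
Qed.

Lemma Rabs_tjap (p t : R) : Rabs (tjap p t) <= Rpower (jap t) (p + 1).
Proof.
  unfold tjap; rewrite Rabs_mult, (Rabs_pos_eq (Rpower _ _)) by (left; apply Rpower_pos).
  rewrite Rpower_plus, Rpower_1 by apply jap_pos.
  generalize (Rabs_le_jap t) (Rpower_pos (jap t) p); nra.
Qed.

(** The two weights, one centred at 0 and one at [x], are what a Cauchy integral
    evaluated above the point [x] of the real axis requires; the bound does not
    depend on [x]. *)
Lemma RInt_gen_jap_decay (F : R -> C) (eta a b x : R) :
  0 < eta <= 1 -> 0 <= a -> 0 <= b ->
  (forall t, Cmod (F t) <= a * Rpower (jap t) (- 1 - eta)
                         + b * Rpower (jap (t - x)) (- 1 - eta)) ->
  Cmod (RInt_gen (V := C_R_CompleteNormedModule) F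
          (Rbar_locally m_infty) (Rbar_locally p_infty)) <= 6 / eta * (a + b).
Proof.
  intros He Ha Hb HF.
  (* The leading power of the derivative comes from the second term; the first
     one makes up for its negative lower-order part. *)
  pose (P := fun t => 2 * tjap (-1) t - tjap (-1 - eta) t).
  pose (P' := fun t => 2 * tjap' (-1) t - tjap' (-1 - eta) t).
  assert (HP : forall t, is_derive P t (P' t)).
  { intros t; apply (is_derive_minus (fun t => 2 * tjap (-1) t) (tjap (-1 - eta))).
    - apply is_derive_scal, is_derive_tjap.
    - apply is_derive_tjap. }
  assert (HcP : forall t, continuous P' t).
  { intros t; apply (continuous_minus (fun t => 2 * tjap' (-1) t) (tjap' (-1 - eta)));
      [apply (continuous_scal_r (V := R_NormedModule))|]; apply continuous_tjap'. }
  assert (HbP : forall t, Rabs (P t) <= 3).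
  { intros t; unfold P.
    assert (H1 := Rabs_tjap (-1) t); assert (H2 := Rabs_tjap (-1 - eta) t).
    replace (-1 + 1) with 0 in H1 by ring; rewrite Rpower_O in H1 by apply jap_pos.
    assert (H3 : Rpower (jap t) (-1 - eta + 1) <= 1).
    { rewrite <- (Rpower_O (jap t) (jap_pos t)) at 2.
      apply Rle_Rpower; [apply jap_ge_1|lra]. }
    apply Rabs_le_between in H1; apply Rabs_le_between in H2.
    apply Rabs_le; lra. }
  assert (HmP : forall t, eta * Rpower (jap t) (- 1 - eta) <= P' t).
  { intros t; unfold P', tjap'.
    assert (H3 : Rpower (jap t) (-1 - eta - 2) <= Rpower (jap t) (-1 - 2)).
    { apply Rle_Rpower; [apply jap_ge_1|lra]. }
    generalize (Rpower_pos (jap t) (-1 - eta - 2)); nra. }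
  replace (6 / eta * (a + b)) with (2 * (3 / eta * (a + b))) by (field; lra).
  apply (RInt_gen_Cmod_le F (fun t => a / eta * P' t + b / eta * P' (t - x))
           (fun t => a / eta * P t + b / eta * P (t - x))).
  - intros t; apply Rle_trans with (1 := HF t).
    assert (Ha' : 0 <= a / eta) by (apply Rdiv_le_0_compat; lra).
    assert (Hb' : 0 <= b / eta) by (apply Rdiv_le_0_compat; lra).
    replace a with (a / eta * eta) at 1 by (field; lra).
    replace b with (b / eta * eta) at 1 by (field; lra).
    rewrite !Rmult_assoc.
    apply Rplus_le_compat; apply Rmult_le_compat_l; auto.
  - intros t.
    apply (is_derive_plus (fun t => a / eta * P t) (fun t => b / eta * P (t - x))).
    + apply is_derive_scal, HP.
    + apply is_derive_scal.
      rewrite <- (Rmult_1_l (P' (t - x))).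
      apply (is_derive_comp P (fun t => t - x)); [apply HP|].
      auto_derive; [exact I|ring].
  - intros t.
    apply (continuous_plus (fun t => a / eta * P' t) (fun t => b / eta * P' (t - x)));
      apply (continuous_scal_r (V := R_NormedModule)); [apply HcP|].
    apply (continuous_comp (fun t => t - x) P'); [|apply HcP].
    apply (ex_derive_continuous (fun t => t - x)); auto_derive; exact I.
  - intros t.
    assert (Ha' : 0 <= a / eta) by (apply Rdiv_le_0_compat; lra).
    assert (Hb' : 0 <= b / eta) by (apply Rdiv_le_0_compat; lra).
    apply Rle_trans with (1 := Rabs_triang _ _).
    rewrite !Rabs_mult, (Rabs_pos_eq _ Ha'), (Rabs_pos_eq _ Hb').
    replace (3 / eta * (a + b)) with (a / eta * 3 + b / eta * 3) by (field; lra).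
    apply Rplus_le_compat; apply Rmult_le_compat_l; auto.
Qed.

(** Let [L] be the sinusoid, [q^2 = 1 + x^2 + y^2], [H] the function [tjap p] with
    [p = -3/4] and [h] its derivative, so that [h(L)] is at least a quarter of
    [<L>^p].  Since [L'' = - L] and [<L>^2 + L'^2 = q^2],
    [h(L) q^2 = (H(L) L')' + H(L) L + h(L) <L>^2].  The last two terms and
    [H(L) L'] are bounded by the power [p + 2] of [q], and division by [q^2] leaves
    the power [p].  A majorant with an explicit integral is produced, which
    avoids any case distinction on the position of the zeros of [L]. *)
Lemma oscillation_majorant (x y a b : R) :
  a <= b ->
  exists (psi : R -> R) (c : R),
    is_RInt psi a b c /\
    (forall phi, Rpower (jap (x * cos phi + y * sin phi)) (- (3 / 4)) <= psi phi) /\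
    c <= (8 + 8 * (b - a)) * Rpower (sqrt (1 + x ^ 2 + y ^ 2)) (- (3 / 4)).
Proof.
  intros Hab.
  set (L := fun phi => x * cos phi + y * sin phi).
  set (L' := fun phi => - x * sin phi + y * cos phi).
  set (q := sqrt (1 + x ^ 2 + y ^ 2)).
  set (p := - (3 / 4)).
  assert (Hq2 : q ^ 2 = 1 + x ^ 2 + y ^ 2) by (unfold q; rewrite pow2_sqrt; nra).
  assert (Hq1 : 1 <= q) by (unfold q; rewrite <- sqrt_1 at 1; apply sqrt_le_1_alt; nra).
  assert (HLL : forall phi, L phi ^ 2 + L' phi ^ 2 = x ^ 2 + y ^ 2).
  { intros phi; unfold L, L'.
    transitivity ((x ^ 2 + y ^ 2) * (Rsqr (sin phi) + Rsqr (cos phi)));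
      [unfold Rsqr; ring | rewrite sin2_cos2; ring]. }
  assert (HL : forall phi, is_derive L phi (L' phi)).
  { intros phi; unfold L, L'; auto_derive; [exact I|ring]. }
  assert (HL' : forall phi, is_derive L' phi (- L phi)).
  { intros phi; unfold L, L'; auto_derive; [exact I|ring]. }
  assert (Hjq : forall phi, jap (L phi) <= q).
  { intros phi; apply jap_le; [lra|]; generalize (HLL phi); nra. }
  assert (HL'q : forall phi, Rabs (L' phi) <= q).
  { intros phi; rewrite <- (Rabs_pos_eq q) by lra.
    apply Rsqr_le_abs_0; unfold Rsqr; generalize (HLL phi); nra. }
  pose (G := fun phi => tjap p (L phi) * L' phi).
  pose (G' := fun phi => L' phi * tjap' p (L phi) * L' phi + tjap p (L phi) * - L phi).
  assert (HG : forall phi, is_derive G phi (G' phi)).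
  { intros phi; unfold G, G'.
    apply (is_derive_mult (fun phi => tjap p (L phi)) L').
    - apply (is_derive_comp (tjap p) L); [apply is_derive_tjap|apply HL].
    - apply HL'.
    - intros; unfold mult; simpl; ring. }
  assert (HcG : forall phi, continuous G' phi).
  { intros phi.
    assert (cL : continuous L phi) by (apply (ex_derive_continuous L); eexists; apply HL).
    assert (cL' : continuous L' phi) by (apply (ex_derive_continuous L'); eexists; apply HL').
    assert (c1 : continuous (fun phi => tjap' p (L phi)) phi)
      by (apply (continuous_comp L (tjap' p)); [exact cL|apply continuous_tjap']).
    assert (c2 : continuous (fun phi => tjap p (L phi)) phi).
    { apply (continuous_comp L (tjap p)); [exact cL|].
      apply (ex_derive_continuous (tjap p)); eexists; apply is_derive_tjap. }
    apply (continuous_plus (fun phi => L' phi * tjap' p (L phi) * L' phi)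
             (fun phi => tjap p (L phi) * - L phi)).
    - apply (continuous_mult (K := R_AbsRing) (fun phi => L' phi * tjap' p (L phi)) L'); [|exact cL'].
      apply (continuous_mult (K := R_AbsRing) L' (fun phi => tjap' p (L phi))); assumption.
    - apply (continuous_mult (K := R_AbsRing) (fun phi => tjap p (L phi)) (fun phi => - L phi)); [exact c2|].
      apply (continuous_opp L), cL. }
  assert (Hq54 : Rpower q (p + 2) = Rpower q p * q ^ 2).
  { rewrite <- (Rpower_pow 2 q) by lra; rewrite <- Rpower_plus; reflexivity. }
  exists (fun phi => 4 / q ^ 2 * (G' phi + 2 * Rpower q (p + 2))).
  exists (4 / q ^ 2 * ((G b - G a) + (b - a) * (2 * Rpower q (p + 2)))).
  split; [|split].
  - apply (is_RInt_scal (V := R_NormedModule) (fun phi => G' phi + 2 * Rpower q (p + 2))).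
    apply (is_RInt_plus (V := R_NormedModule) G' (fun _ => 2 * Rpower q (p + 2))).
    + apply (is_RInt_derive G G'); auto.
    + apply (is_RInt_const (V := R_NormedModule)).
  - intros phi; fold (L phi).
    set (h := tjap' p (L phi)).
    assert (Hj := jap_pos (L phi)).
    assert (Hh : h = 1 / 4 * Rpower (jap (L phi)) p + 3 / 4 * Rpower (jap (L phi)) (p - 2)).
    { unfold h, tjap', p; field. }
    assert (Hh0 := Rpower_pos (jap (L phi)) (p - 2)).
    assert (Hh1 : Rpower (jap (L phi)) (p - 2) <= Rpower (jap (L phi)) p)
      by (apply Rle_Rpower; [apply jap_ge_1|lra]).
    assert (Hp2 : Rpower (jap (L phi)) p * jap (L phi) ^ 2 <= Rpower q (p + 2)).
    { rewrite <- (Rpower_pow 2) by exact Hj; rewrite <- Rpower_plus.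
      apply Rle_Rpower_l; [unfold p; simpl; lra|split; auto]. }
    assert (H1 : h * jap (L phi) ^ 2 <= Rpower q (p + 2)).
    { apply Rle_trans with (2 := Hp2), Rmult_le_compat_r; [nra|lra]. }
    assert (H2 : tjap p (L phi) * L phi <= Rpower q (p + 2)).
    { apply Rle_trans with (2 := Hp2); unfold tjap.
      rewrite jap_sq; generalize (Rpower_pos (jap (L phi)) p); nra. }
    assert (H3 : h * q ^ 2 <= G' phi + 2 * Rpower q (p + 2)).
    { unfold G'; fold h.
      replace (q ^ 2) with (jap (L phi) ^ 2 + L' phi ^ 2)
        by (rewrite jap_sq, Hq2; generalize (HLL phi); lra).
      nra. }
    assert (Hq : 0 < q ^ 2) by nra.
    apply Rmult_le_reg_r with (q ^ 2); [exact Hq|].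
    apply Rle_trans with (4 * (h * q ^ 2)); [nra|].
    replace (4 / q ^ 2 * (G' phi + 2 * Rpower q (p + 2)) * q ^ 2)
      with (4 * (G' phi + 2 * Rpower q (p + 2))) by (field; nra).
    lra.
  - assert (HGb : forall phi, Rabs (G phi) <= Rpower q (p + 2)).
    { intros phi; unfold G; rewrite Rabs_mult.
      replace (p + 2) with (p + 1 + 1) by ring.
      rewrite Rpower_plus, Rpower_1 by lra.
      apply Rmult_le_compat; try apply Rabs_pos; auto.
      apply Rle_trans with (1 := Rabs_tjap p (L phi)).
      apply Rle_Rpower_l; [unfold p; lra|split; [apply jap_pos|auto]]. }
    assert (Ha := HGb a); assert (Hb := HGb b).
    apply Rabs_le_between in Ha; apply Rabs_le_between in Hb.
    apply Rle_trans with (4 / q ^ 2 * (2 * Rpower q (p + 2) + (b - a) * (2 * Rpower q (p + 2)))).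
    + apply Rmult_le_compat_l; [apply Rdiv_le_0_compat; nra|lra].
    + rewrite Hq54; right; field; lra.
Qed.

(** * Decay of the integral over the quarter circle *)

Lemma Cmod_Cpolar (r a : R) : 0 <= r -> Cmod (Cpolar r a) = r.
Proof.
  intros Hr; unfold Cmod, Cpolar; simpl.
  replace (_ + _) with (r ^ 2 * (Rsqr (sin a) + Rsqr (cos a))) by (unfold Rsqr; ring).
  rewrite sin2_cos2, Rmult_1_r; now apply sqrt_pow2.
Qed.

Lemma Cmod_Cpow_principal (w : C) (p : R) :
  Cmod (Cpow_principal w p) = Rpower (Cmod w) p.
Proof. apply Cmod_Cpolar; left; apply Rpower_pos. Qed.

Lemma Cmod_Csqrt_down (w : C) : Cmod (Csqrt_down w) = sqrt (Cmod w).
Proof. apply Cmod_Cpolar, sqrt_pos. Qed.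

(** On this arc [cos phi >= 0 >= sin phi], so the left-over is at least
    [(eps - M) (1 - cos phi) + M (1 + sin phi) >= M (2 - (cos phi - sin phi))],
    and [cos phi - sin phi <= sqrt 2 < 3 / 2]. *)
Lemma Re_base_ge (M eps phi y1 y2 : R) :
  0 < M -> 2 * M < eps -> 3 * PI / 2 <= phi <= 2 * PI ->
  - (eps - M) <= y1 -> y2 <= M ->
  M / 2 <= y1 * cos phi + y2 * sin phi + eps.
Proof.
  intros HM He Hphi H1 H2.
  assert (HPI := PI_RGT_0).
  assert (Hc : 0 <= cos phi) by (apply cos_ge_0_3PI2; lra).
  assert (Hs : sin phi <= 0) by (apply sin_le_0; lra).
  assert (Hsc := sin2_cos2 phi); unfold Rsqr in Hsc.
  assert (Hcs : cos phi - sin phi <= 3 / 2).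
  { apply Rsqr_incr_0_var; [unfold Rsqr|lra].
    generalize (Rle_0_sqr (cos phi + sin phi)); unfold Rsqr; nra. }
  assert (Hc1 := COS_bound phi).
  nra.
Qed.

Lemma I_pm_integrand_le (M eps nu phi g : R) (z w : C) :
  0 < M -> 2 * M < eps -> 0 <= nu ->
  3 * PI / 2 <= phi <= 2 * PI ->
  - (eps - M) <= Im z -> Im w <= M -> Rabs g <= 1 ->
  Cmod (g / Cpow_principal (- Ci * (z * cos phi + w * sin phi + Ci * eps)) (nu + 3 / 2))%C
  <= Rpower (Rmin (M / 2) 1) (- (nu + 3 / 2))
     * Rpower (jap (Re z * cos phi + Re w * sin phi)) (- (3 / 4)).
Proof.
  intros HM He Hnu Hphi Hz Hw Hg.
  set (v := (- Ci * _)%C).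
  set (L := Re z * cos phi + Re w * sin phi).
  set (kap := Rmin (M / 2) 1).
  assert (Hkap : 0 < kap) by (apply Rmin_glb_lt; lra).
  assert (Hkap1 : kap <= M / 2) by apply Rmin_l.
  assert (Hkap2 : kap <= 1) by apply Rmin_r.
  assert (HRe : M / 2 <= Re v).
  { replace (Re v) with (Im z * cos phi + Im w * sin phi + eps)
      by (unfold v; destruct z, w; simpl; ring).
    now apply Re_base_ge. }
  assert (HIm : Im v = - L) by (unfold v, L; destruct z, w; simpl; ring).
  assert (Hj := jap_pos L); assert (Hj2 := jap_sq L); assert (Hj1 := jap_ge_1 L).
  assert (Hv : kap * jap L <= Cmod v).
  { assert (H := Cmod2_alt v); rewrite HIm in H.
    assert (Hk1 : kap ^ 2 <= Re v ^ 2) by (apply pow_incr; lra).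
    assert (Hk2 : kap ^ 2 * L ^ 2 <= 1 * L ^ 2)
      by (apply Rmult_le_compat_r; [apply pow2_ge_0|nra]).
    apply Rsqr_incr_0_var; [rewrite !Rsqr_pow2|apply Cmod_ge_0].
    rewrite Rpow_mult_distr, Hj2, H; lra. }
  assert (Hv1 : kap <= Cmod v) by nra.
  assert (Hpow : Cpow_principal v (nu + 3 / 2) <> 0).
  { apply Cmod_gt_0; rewrite Cmod_Cpow_principal; apply Rpower_pos. }
  rewrite Cmod_div, Cmod_R, Cmod_Cpow_principal by exact Hpow.
  unfold Rdiv at 1; rewrite <- Rpower_Ropp.
  apply Rle_trans with (1 * Rpower (Cmod v) (- (nu + 3 / 2))).
  { apply Rmult_le_compat_r; [left; apply Rpower_pos|exact Hg]. }
  rewrite Rmult_1_l.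
  (* Part of the exponent is spent on the lower bound of the base; only 3/4 of
     it is kept as decay in [L]. *)
  replace (- (nu + 3 / 2)) with (- (nu + 3 / 4) + - (3 / 4)) by field.
  rewrite !Rpower_plus, Rmult_assoc.
  apply Rmult_le_compat; try (left; apply Rpower_pos).
  - apply Rpower_le_neg; lra.
  - rewrite Rpower_mult_distr by lra.
    apply Rpower_le_neg; nra.
Qed.

Lemma I_pm_decay (M eps nu : R) (f : R -> R -> R) (z w : C) :
  0 < M -> 2 * M < eps -> 0 <= nu ->
  (forall phi, 3 * PI / 2 <= phi <= 2 * PI -> Rabs (f (PI / 2) phi) <= 1) ->
  - (eps - M) <= Im z -> Im w <= M ->
  Cmod (I_pm f nu eps z w) <=
    Rpower (Rmin (M / 2) 1) (- (nu + 3 / 2)) * (8 + 4 * PI)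
    * Rpower (sqrt (1 + Re z ^ 2 + Re w ^ 2)) (- (3 / 4)).
Proof.
  intros HM He Hnu Hf Hz Hw.
  assert (HPI := PI_RGT_0).
  assert (Hle : 3 * PI / 2 <= 2 * PI) by lra.
  destruct (oscillation_majorant (Re z) (Re w) _ _ Hle) as [psi [c [Hpsi [Hle' Hc]]]].
  set (kap := Rpower (Rmin (M / 2) 1) _).
  assert (Hkap : 0 < kap) by apply Rpower_pos.
  apply Rle_trans with (kap * c).
  - apply (RInt_Cmod_le _ (fun phi => kap * psi phi)); [exact Hle| |].
    + intros phi Hphi.
      apply Rle_trans with (kap * Rpower (jap (Re z * cos phi + Re w * sin phi)) (- (3 / 4))).
      * apply I_pm_integrand_le; auto.
      * apply Rmult_le_compat_l; [lra|apply Hle'].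
    + apply (is_RInt_scal (V := R_NormedModule)); exact Hpsi.
  - rewrite Rmult_assoc; apply Rmult_le_compat_l; [lra|].
    replace (8 + 4 * PI) with (8 + 8 * (2 * PI - 3 * PI / 2)) by field; exact Hc.
Qed.

(** At the end point [2 PI] the value is that on the cut at [phi = 0]. *)
Lemma equatorial_trace_le_1 (u : R3 -> R) (beta phi : R) :
  equatorial_trace (spherical u (PI / 2)) beta ->
  3 * PI / 2 <= phi <= 2 * PI -> Rabs (spherical u (PI / 2) phi) <= 1.
Proof.
  intros [H0 [_ [H1 _]]] Hphi.
  assert (HPI := PI_RGT_0).
  destruct (Req_dec phi (2 * PI)) as [->|Hne].
  - replace (spherical u (PI / 2) (2 * PI)) with (spherical u (PI / 2) 0).
    + rewrite H0 by lra; rewrite Rabs_R0; lra.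
    + unfold spherical; now rewrite cos_2PI, sin_2PI, cos_0, sin_0.
  - assert (H := H1 phi); rewrite Rabs_pos_eq; lra.
Qed.

(** * Contours *)

Definition locally_bounded (f : R -> R) : Prop :=
  forall t, exists c, locally t (fun x => f x <= c).

Lemma locally_bounded_segment (f : R -> R) (a b : R) :
  locally_bounded f -> exists c, forall t, a <= t <= b -> f t <= c.
Proof.
  intros Hf.
  destruct (Rle_dec a b) as [Hab|Hab]; [|exists 0; intros t Ht; lra].
  pose (E := fun x => a <= x <= b /\ exists c, forall t, a <= t <= x -> f t <= c).
  assert (HEa : E a).
  { split; [lra|exists (f a)]; intros t Ht.
    replace t with a by lra; lra. }
  destruct (completeness E) as [m [Hm1 Hm2]].
  { exists b; intros x [Hx _]; lra. }
  { now exists a. }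
  assert (Ham : a <= m) by now apply Hm1.
  assert (Hmb : m <= b) by (apply Hm2; intros x [Hx _]; lra).
  destruct (Hf m) as [c0 [d Hd]].
  assert (Hx : exists x, E x /\ m - d < x).
  { apply NNPP; intros Hn.
    assert (m <= m - d); [|destruct d; simpl in *; lra].
    apply Hm2; intros x Hx; apply Rnot_lt_le; intros Hlt; apply Hn; now exists x. }
  destruct Hx as [x [[Hx [c1 Hc1]] Hxm]].
  assert (Hdp := cond_pos d).
  assert (HEz : E (Rmin b (m + d / 2))).
  { split; [split; [apply Rmin_glb; lra|apply Rmin_l]|].
    exists (Rmax c0 c1); intros t [Ht1 Ht2].
    assert (Ht3 := Rmin_r b (m + d / 2)).
    destruct (Rle_dec t x).
    - apply Rle_trans with (2 := Rmax_r c0 c1); apply Hc1; lra.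
    - apply Rle_trans with (2 := Rmax_l c0 c1); apply Hd.
      apply Rabs_def1; unfold minus, plus, opp; simpl; lra. }
  assert (Hz := Hm1 _ HEz).
  destruct HEz as [_ [c Hc]].
  exists c; intros t Ht; apply Hc; split; [lra|].
  unfold Rmin in *; destruct (Rle_dec b (m + d / 2)); lra.
Qed.

Lemma locally_bounded_tail (f : R -> R) (T c : R) :
  locally_bounded f -> (forall t, T <= Rabs t -> f t <= c) ->
  exists c', 0 < c' /\ forall t, f t <= c'.
Proof.
  intros Hf Hc.
  destruct (locally_bounded_segment f (- T) T Hf) as [c0 Hc0].
  exists (Rmax 1 (Rmax c c0)); split.
  - apply Rlt_le_trans with (2 := Rmax_l _ _); lra.
  - intros t; apply Rle_trans with (2 := Rmax_r _ _).
    destruct (Rle_dec T (Rabs t)) as [H|H].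
    + apply Rle_trans with (2 := Rmax_l _ _); auto.
    + apply Rle_trans with (2 := Rmax_r _ _); apply Hc0.
      apply Rnot_le_lt, Rabs_def2 in H; lra.
Qed.

Lemma continuous_locally_bounded (f : R -> R) :
  (forall t, continuous f t) -> locally_bounded f.
Proof.
  intros Hf t; exists (f t + 1).
  apply (Hf t (fun y => y <= f t + 1)).
  exists (mkposreal 1 Rlt_0_1); intros y Hy.
  apply Rabs_def2 in Hy; unfold minus, plus, opp in Hy; simpl in Hy; lra.
Qed.

Lemma continuous_Cmod {U : UniformSpace} (f : U -> C) (x : U) :
  continuous (U := C_UniformSpace) f x -> continuous (fun x => Cmod (f x)) x.
Proof.
  intros Hf.
  apply (continuous_comp (V := C_UniformSpace) f Cmod); [exact Hf|].
  unfold continuous; rewrite <- (norm_C_R (f x)).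
  apply (filterlim_ext (F := locally (T := C_R_CompleteNormedModule) (f x))
           (norm (V := C_R_CompleteNormedModule))); [apply norm_C_R|].
  apply (filterlim_norm (V := C_R_CompleteNormedModule)).
Qed.

Lemma filterlim_Cmod_le {T : Type} (F : (T -> Prop) -> Prop) (f : T -> C) (l : C) :
  filterlim f F (locally (T := C_UniformSpace) l) ->
  F (fun x => Cmod (f x) <= Cmod l + 1).
Proof.
  intros Hf; apply (Hf (fun y => Cmod y <= Cmod l + 1)).
  apply (continuous_Cmod (U := C_UniformSpace) (fun y => y) l (continuous_id l)
           (fun r => r <= Cmod l + 1)).
  exists (mkposreal 1 Rlt_0_1); intros y Hy.
  apply Rabs_def2 in Hy; unfold minus, plus, opp in Hy; simpl in Hy; lra.
Qed.

Lemma contour_continuous (A : contour) (t : R) :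
  continuous (U := C_UniformSpace) A t.
Proof. apply (path_piecewise_C1 A). Qed.

Lemma continuous_Cmod_sub (A : contour) (z : C) (t : R) :
  continuous (fun t => Cmod (A t - z)) t.
Proof.
  apply (continuous_Cmod (fun t => A t - z)%C).
  apply (continuous_minus (V := C_R_NormedModule) A (fun _ => z));
    [apply contour_continuous|apply continuous_const].
Qed.

(** At a corner the value of the total derivative is arbitrary, but it is one
    value, and the two one-sided limits bound the derivative nearby. *)
Lemma path_deriv_bounded (A : contour) :
  exists c, 0 < c /\ forall t, Cmod (path_deriv A t) <= c.
Proof.
  destruct (path_ends A) as [T HT].
  (* Beyond [T] by a margin, the path is a horizontal line in a neighbourhood. *)
  apply (locally_bounded_tail _ (Rabs T + 1) 1).
  - intros t.
    destruct (path_piecewise_C1 A) as [_ [l [Hout Hin]]].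
    destruct (classic (In t l)) as [H|H].
    + destruct (Hin t H) as [dl [dr [Hl Hr]]].
      apply filterlim_Cmod_le in Hl; apply filterlim_Cmod_le in Hr.
      pose (c0 := Cmod (path_deriv A t)).
      exists (c0 + (Cmod dl + 1) + (Cmod dr + 1)).
      unfold at_left, at_right, within in Hl, Hr.
      generalize (filter_and _ _ Hl Hr); apply filter_imp; intros x [H1 H2].
      assert (H3 := Cmod_ge_0 dl); assert (H4 := Cmod_ge_0 dr).
      assert (H5 : 0 <= c0) by apply Cmod_ge_0.
      destruct (Rtotal_order x t) as [Hx|[->|Hx]].
      * specialize (H1 Hx); lra.
      * fold c0; lra.
      * specialize (H2 Hx); lra.
    + eexists; apply (filterlim_Cmod_le (locally t) (path_deriv A) (path_deriv A t)).
      apply (Hout t H).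
  - intros t Ht.
    assert (Htail : forall x : R, Rabs (x - t) < 1 -> T <= Rabs x).
    { intros x Hx.
      assert (H := Rabs_triang_inv t (t - x)); rewrite (Rabs_minus_sym t x) in H.
      replace (t - (t - x)) with x in H by ring.
      generalize (Rle_abs T); lra. }
    assert (Hloc : locally t (fun x : R => A x = (x, height A))).
    { exists (mkposreal 1 Rlt_0_1); intros x Hx; apply HT, Htail, Hx. }
    replace (path_deriv A t) with (RtoC 1); [rewrite Cmod_1; lra|].
    unfold path_deriv, RtoC; f_equal; symmetry; apply is_derive_unique.
    + apply (is_derive_ext_loc (fun x => x)); [|apply (is_derive_id (K := R_AbsRing))].
      revert Hloc; apply filter_imp; intros x ->; reflexivity.
    + apply (is_derive_ext_loc (fun _ => height A));
        [|apply (is_derive_const (K := R_AbsRing) (V := R_NormedModule))].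
      revert Hloc; apply filter_imp; intros x ->; reflexivity.
Qed.

Lemma Im_le_Cmod (z : C) : Rabs (Im z) <= Cmod z.
Proof.
  apply Rle_trans with (2 := Rmax_Cmod z); apply Rmax_r.
Qed.

Lemma Cmod_le_Rabs (z : C) : Cmod z <= Rabs (Re z) + Rabs (Im z).
Proof.
  apply Rsqr_incr_0_var; [|generalize (Rabs_pos (Re z)) (Rabs_pos (Im z)); lra].
  rewrite !Rsqr_pow2, Cmod2_alt, <- (pow2_abs (Re z)), <- (pow2_abs (Im z)).
  generalize (Rabs_pos (Re z)) (Rabs_pos (Im z)); nra.
Qed.

Lemma contour_segment_bounded (A : contour) (T : R) :
  exists P, 0 < P /\ forall t, Rabs t <= T -> Cmod (A t) <= P.
Proof.
  destruct (locally_bounded_segment (fun t => Cmod (A t)) (- T) T) as [c Hc].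
  { apply continuous_locally_bounded; intros t.
    apply continuous_Cmod, contour_continuous. }
  exists (Rmax 1 c); split; [apply Rlt_le_trans with (2 := Rmax_l _ _); lra|].
  intros t Ht; apply Rle_trans with (2 := Rmax_r _ _), Hc.
  now apply Rabs_le_between.
Qed.

Lemma contour_Im_bounded (A : contour) :
  exists c, 0 < c /\ forall t, Rabs (Im (A t)) <= c.
Proof.
  destruct (path_ends A) as [T HT].
  destruct (contour_segment_bounded A T) as [P [HP1 HP]].
  exists (P + Rabs (height A)); split; [generalize (Rabs_pos (height A)); lra|].
  intros t; destruct (Rle_dec T (Rabs t)) as [H|H].
  - rewrite (HT t H); simpl; lra.
  - apply Rle_trans with (1 := Im_le_Cmod _).
    generalize (HP t); generalize (Rabs_pos (height A)); lra.
Qed.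

(** On a contour the real part is as large as the parameter, up to a constant. *)
Lemma contour_jap_Re (A : contour) :
  exists c, 1 <= c /\ forall t, jap t <= c * jap (Re (A t)).
Proof.
  destruct (path_ends A) as [T HT].
  exists (1 + Rabs T); split; [generalize (Rabs_pos T); lra|].
  intros t; assert (Hj := jap_ge_1 (Re (A t))); assert (HTp := Rabs_pos T).
  destruct (Rle_dec T (Rabs t)) as [H|H].
  - rewrite (HT t H) in *; simpl in *; nra.
  - apply Rle_trans with (1 + Rabs T); [|nra].
    apply Rle_trans with (1 := jap_le_1_Rabs t).
    generalize (Rle_abs T); lra.
Qed.

Lemma continuous_jap (t : R) : continuous jap t.
Proof.
  apply (continuous_ext (fun t => Rpower (jap t) 1)).
  - intros x; apply Rpower_1, jap_pos.
  - apply continuous_Rpower_jap.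
Qed.

Lemma contour_distance_point (A : contour) (z : C) :
  (forall t, A t <> z) ->
  exists c, 0 < c /\ forall t, jap t <= c * Cmod (A t - z).
Proof.
  intros Hz.
  assert (Hpos : forall t, 0 < Cmod (A t - z)).
  { intros t; apply Cmod_gt_0; intros H; apply (Hz t).
    replace (A t) with (A t - z + z)%C by ring; rewrite H; ring. }
  destruct (path_ends A) as [T HT].
  destruct (locally_bounded_tail (fun t => jap t * / Cmod (A t - z))
              (Rabs T + 2 * Cmod z + 1) 4) as [c [Hc1 Hc]].
  - apply continuous_locally_bounded; intros t.
    apply (continuous_mult (K := R_AbsRing) jap (fun t => / Cmod (A t - z))).
    + apply continuous_jap.
    + apply continuous_Rinv_comp; [apply continuous_Cmod_sub|].
      generalize (Hpos t); lra.
  - intros t Ht.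
    apply Rmult_le_reg_r with (Cmod (A t - z)); [apply Hpos|].
    rewrite Rmult_assoc, Rinv_l by (generalize (Hpos t); lra).
    assert (H1 := re_le_Cmod (A t - z)); assert (H2 := re_le_Cmod z).
    assert (HTa := Rle_abs T); assert (HTp := Rabs_pos T); assert (Hzp := Cmod_ge_0 z).
    rewrite HT in * by lra; simpl in H1.
    assert (H3 := Rabs_triang_inv t (Re z)).
    assert (H4 := jap_le_1_Rabs t).
    unfold Rminus in H3; unfold Re in *; lra.
  - exists c; split; [exact Hc1|]; intros t.
    assert (H := Hc t); assert (Hp := Hpos t).
    replace (jap t) with (jap t * / Cmod (A t - z) * Cmod (A t - z)) by (field; lra).
    apply Rmult_le_compat_r; lra.
Qed.

(** Connectedness of an interval: the last point of [U] in it is in [L] too. *)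
Lemma segment_connected (U L : R -> Prop) (a b : R) :
  closed U -> closed L -> (forall x, U x \/ L x) ->
  a <= b -> U a -> L b -> exists x, a <= x <= b /\ U x /\ L x.
Proof.
  intros HU HL Hcov Hab Ha Hb.
  pose (E := fun x => x <= b /\ U x).
  destruct (completeness E) as [m [Hm1 Hm2]].
  { exists b; intros x [Hx _]; exact Hx. }
  { now exists a. }
  assert (Ham : a <= m) by (apply Hm1; now split).
  assert (Hmb : m <= b) by (apply Hm2; intros x [Hx _]; exact Hx).
  exists m; split; [lra|].
  assert (HUm : U m).
  { apply HU; intros [d Hd].
    assert (m <= m - d); [|destruct d; simpl in *; lra].
    apply Hm2; intros x [Hx1 Hx2]; apply Rnot_lt_le; intros Hlt.
    assert (Hxm : x <= m) by (apply Hm1; now split).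
    apply (Hd x); [|exact Hx2].
    apply Rabs_def1; unfold minus, plus, opp; simpl; destruct d; simpl in *; lra. }
  split; [exact HUm|].
  destruct (Req_dec m b) as [->|Hne]; [exact Hb|].
  apply HL; intros [d Hd].
  assert (Hdp := cond_pos d).
  pose (x := Rmin b (m + d / 2)).
  assert (Hx1 : x <= b) by apply Rmin_l.
  assert (Hx2 : x <= m + d / 2) by apply Rmin_r.
  assert (Hx3 : m < x) by (apply Rmin_glb_lt; lra).
  destruct (Hcov x) as [H|H].
  - assert (x <= m) by (apply Hm1; now split); lra.
  - apply (Hd x); [|exact H].
    apply Rabs_def1; unfold minus, plus, opp; simpl; lra.
Qed.

(** Let [Im z < 0].  If [z] is far from the origin, the ray from [z] vertically
    downwards misses the contour, so it stays on one side, and it ends on the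
    lower side. *)
Lemma upper_far (A : contour) :
  height A = 0 ->
  exists rho, forall z, upper A z -> rho < Cmod z -> 0 <= Im z.
Proof.
  intros Hh.
  destruct (path_ends A) as [T HT].
  destruct (contour_segment_bounded A T) as [P [HP1 HP]].
  destruct (sides_far A) as [Y HY].
  exists P; intros z Hz Hrho; apply Rnot_lt_le; intros Him.
  pose (ray := fun y : R => (Re z, Im z - y) : C).
  assert (Hc : forall y, continuous (U := C_UniformSpace) ray y).
  { intros y; apply filterlim_locally; intros e.
    exists e; intros x Hx; split.
    - apply ball_center.
    - assert (Hx' : Rabs (x - y) < e) by exact Hx.
      change (Rabs (Im z - x - (Im z - y)) < e).
      replace (Im z - x - (Im z - y)) with (- (x - y)) by ring.
      now rewrite Rabs_Ropp. }
  destruct (segment_connected (fun y => upper A (ray y)) (fun y => lower A (ray y))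
              0 (Rabs Y + 1)) as [y [Hy [HU HL]]].
  - apply (closed_comp (U := C_UniformSpace) ray); [intros; apply Hc|apply upper_closed].
  - apply (closed_comp (U := C_UniformSpace) ray); [intros; apply Hc|apply lower_closed].
  - intros y; apply sides_cover.
  - generalize (Rabs_pos Y); lra.
  - unfold ray; rewrite Rminus_0_r; now destruct z.
  - apply HY; simpl; generalize (Rle_abs Y); lra.
  - destruct (proj1 (sides_meet A (ray y)) (conj HU HL)) as [t Ht].
    destruct (Rle_dec T (Rabs t)) as [H|H].
    + rewrite (HT t H) in Ht; injection Ht; intros; lra.
    + assert (Cmod (A t) <= P) by (apply HP; lra).
      assert (Cmod z <= Cmod (A t)); [|lra].
      rewrite <- Ht.
      apply Rsqr_incr_0_var; [|apply Cmod_ge_0].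
      rewrite !Rsqr_pow2, !Cmod2_alt; simpl; nra.
Qed.

(** The first bound controls the Cauchy kernel uniformly in [z]; the second says
    that a point of [B] cannot be near the origin and near [z] at the same time. *)
Lemma contour_separation (A B : contour) :
  height A = 0 -> contour_below B A ->
  exists c rho, 0 < c <= 1 /\ 0 < rho /\
    forall z t, upper A z -> rho < Cmod z ->
      c * jap (t - Re z) <= Cmod (B t - z) /\ c * Cmod z <= Cmod (B t - z) + jap t.
Proof.
  intros Hh [HhB _].
  destruct (upper_far A Hh) as [r0 Hr0].
  destruct (path_ends B) as [T HT].
  destruct (contour_segment_bounded B T) as [P [HP1 HP]].
  assert (HTp := Rabs_pos T); assert (HTa := Rle_abs T).
  rewrite Hh in HhB.
  exists (Rmin (1 / 4) (- height B)), (Rmax r0 (2 * P + 1 + Rabs T - 2 * height B)).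
  assert (Hc0 : 0 < Rmin (1 / 4) (- height B)) by (apply Rmin_glb_lt; lra).
  assert (Hc1 := Rmin_l (1 / 4) (- height B)).
  assert (Hc2 := Rmin_r (1 / 4) (- height B)).
  set (c := Rmin _ _) in *.
  split; [lra|]; split; [apply Rlt_le_trans with (2 := Rmax_r _ _); lra|].
  intros z t Hz Hrho.
  assert (Hr : r0 < Cmod z) by (apply Rle_lt_trans with (2 := Hrho); apply Rmax_l).
  assert (Hr' : 2 * P + 1 + Rabs T - 2 * height B < Cmod z)
    by (apply Rle_lt_trans with (2 := Hrho); apply Rmax_r).
  assert (HIm := Hr0 z Hz Hr).
  assert (Htri : Cmod z <= Cmod (B t - z) + Cmod (B t)).
  { replace z with (- (B t - z) + B t)%C at 1 by ring.
    rewrite <- (Cmod_opp (B t - z)); apply Cmod_triangle. }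
  assert (Hj := jap_ge_1 t); assert (Hj' := jap_ge_1 (t - Re z)).
  assert (Hjt := Rabs_le_jap t); assert (HD := Cmod_ge_0 (B t - z)).
  destruct (Rle_dec T (Rabs t)) as [H|H].
  - assert (HBt : Cmod (B t) <= jap t - height B).
    { rewrite (HT t H); apply Rle_trans with (1 := Cmod_le_Rabs _); simpl.
      rewrite (Rabs_left (height B)); lra. }
    split; [|nra].
    apply Rsqr_incr_0_var; [|exact HD].
    rewrite !Rsqr_pow2, Rpow_mult_distr, jap_sq, Cmod2_alt, (HT t H).
    unfold Re, Im in *; simpl.
    assert (c * c <= 1) by nra.
    assert (c * c <= height B * height B) by nra.
    generalize (pow2_ge_0 (t - fst z)); nra.
  - assert (HBt : Cmod (B t) <= P) by (apply HP; lra).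
    split; [|nra].
    assert (H1 := jap_le_1_Rabs (t - Re z)).
    assert (H2 := re_le_Cmod z).
    assert (H3 := Rabs_triang t (- Re z)); rewrite Rabs_Ropp in H3.
    unfold Rminus in *; nra.
Qed.

(** * The two Cauchy brackets *)

Lemma analytic_on_continuous (D : C -> C -> Prop) (F : C -> C -> C) (B : contour) (z : C) :
  analytic_on D F -> (forall t, D z (B t)) ->
  forall t, continuous (fun t => Cmod (F z (B t))) t.
Proof.
  intros [U [_ [HDU HU]]] HD t.
  apply (continuous_Cmod (fun t => F z (B t))).
  apply (continuous_comp_2 (V := C_UniformSpace) (W := C_UniformSpace) (X := C_UniformSpace)
           (fun _ => z) B F t).
  - apply continuous_const.
  - apply contour_continuous.
  - apply (filterdiff_continuous (K := C_AbsRing)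
             (U := prod_NormedModule C_AbsRing C_NormedModule C_NormedModule)
             (V := C_NormedModule) (fun q => F (fst q) (snd q)) (z, B t)).
    apply HU, HDU, HD.
Qed.

Lemma quotient_bounded (B : contour) (F G : C -> C) :
  (forall t, continuous (fun t => Cmod (F (B t))) t) ->
  (forall t, continuous (fun t => Cmod (G (B t))) t) ->
  (forall t, G (B t) <> 0) ->
  bigO_on (on B) (fun z => F z / G z)%C (fun _ => 1) ->
  exists c, 0 < c /\ forall t, Cmod (F (B t) / G (B t)) <= c.
Proof.
  intros HF HG HG0 [c [rho Hc]].
  destruct (path_ends B) as [T HT].
  apply (locally_bounded_tail _ (Rabs T + Rabs rho + 1) c).
  - apply continuous_locally_bounded; intros t.
    apply (continuous_ext (fun t => Cmod (F (B t)) * / Cmod (G (B t)))).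
    + intros x; symmetry; now apply Cmod_div.
    + apply (continuous_mult (K := R_AbsRing) (fun t => Cmod (F (B t))) (fun t => / Cmod (G (B t))));
        [apply HF|].
      apply continuous_Rinv_comp; [apply HG|].
      apply Rgt_not_eq, Cmod_gt_0, HG0.
  - intros t Ht.
    assert (H1 := Rle_abs T); assert (H2 := Rle_abs rho).
    assert (H3 := Rabs_pos T); assert (H4 := Rabs_pos rho).
    rewrite <- (Rmult_1_r c); apply Hc; [|now exists t].
    apply Rlt_le_trans with (2 := re_le_Cmod _).
    rewrite HT by lra; simpl; lra.
Qed.

(** The exponent [-1/4] of the joint weight is shared equally between the two
    variables; with the Cauchy kernel the weight in the variable of integration
    becomes the integrable [-9/8]. *)
Lemma bracket_plus_o_decay (B1 B2 : contour) (Psi : C -> C -> C) (z1 : C) (c0 : R) :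
  (forall t, B1 t <> z1) ->
  (forall tau t, Cmod (Psi (B1 tau) (B2 t)) <=
     c0 * Rpower (sqrt (1 + Re (B1 tau) ^ 2 + Re (B2 t) ^ 2)) (- (1 / 4))) ->
  exists c, 0 < c /\ forall t,
    Cmod (bracket_plus_o B1 Psi z1 (B2 t)) <= c * Rpower (jap t) (- (1 / 8)).
Proof.
  intros Hz HPsi.
  destruct (contour_distance_point B1 z1 Hz) as [cz [Hcz1 Hcz]].
  destruct (path_deriv_bounded B1) as [cd [Hcd1 Hcd]].
  destruct (contour_jap_Re B1) as [r1 [Hr11 Hr1]].
  destruct (contour_jap_Re B2) as [r2 [Hr21 Hr2]].
  assert (Hc0 : 0 <= c0).
  { assert (H := HPsi 0 0); assert (H' := Cmod_ge_0 (Psi (B1 0) (B2 0))).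
    assert (Hp := Rpower_pos (sqrt (1 + Re (B1 0) ^ 2 + Re (B2 0) ^ 2)) (- (1 / 4))); nra. }
  set (e := - (1 / 8)).
  pose (a := c0 * Rpower (/ r1) e * Rpower (/ r2) e * cz * cd).
  assert (Ha : 0 <= a).
  { unfold a; repeat apply Rmult_le_pos; try lra; left; apply Rpower_pos. }
  pose (c1 := Cmod (/ (2 * PI * Ci))%C).
  assert (Hc1 : 0 <= c1) by apply Cmod_ge_0.
  exists (c1 * (48 * a) + 1); split; [nra|]; intros t.
  assert (Hjt := Rpower_pos (jap t) e).
  unfold bracket_plus_o, contour_integral; rewrite Cmod_mult; fold c1.
  assert (HI : Cmod (RInt_gen (V := C_R_CompleteNormedModule)
                (fun tau => (Psi (B1 tau) (B2 t) / (B1 tau - z1) * path_deriv B1 tau)%C)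
                (Rbar_locally m_infty) (Rbar_locally p_infty))
               <= 6 / (1 / 8) * (a * Rpower (jap t) e + 0)).
  { apply (RInt_gen_jap_decay _ (1 / 8) (a * Rpower (jap t) e) 0 0); [lra|nra|lra|].
    intros tau.
    rewrite Rmult_0_l, Rplus_0_r.
    assert (Hne : (B1 tau - z1)%C <> 0).
    { intros H; apply (Hz tau).
      replace (B1 tau) with (B1 tau - z1 + z1)%C by ring; rewrite H; ring. }
    assert (Hne' := proj1 (Cmod_gt_0 _) Hne).
    rewrite Cmod_mult, Cmod_div by exact Hne.
    set (q := sqrt (1 + Re (B1 tau) ^ 2 + Re (B2 t) ^ 2)) in *.
    assert (Hq1 : jap (Re (B1 tau)) <= q) by (apply sqrt_le_1_alt; nra).
    assert (Hq2 : jap (Re (B2 t)) <= q) by (apply sqrt_le_1_alt; nra).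
    assert (Hj1 := jap_pos tau); assert (Hj2 := jap_pos t).
    assert (Hi1 : 0 < / r1) by (apply Rinv_0_lt_compat; lra).
    assert (Hi2 : 0 < / r2) by (apply Rinv_0_lt_compat; lra).
    assert (Hq3 : / r1 * jap tau <= q).
    { apply Rle_trans with (2 := Hq1).
      apply Rmult_le_reg_l with r1; [lra|].
      rewrite <- Rmult_assoc, Rinv_r, Rmult_1_l by lra; apply Hr1. }
    assert (Hq4 : / r2 * jap t <= q).
    { apply Rle_trans with (2 := Hq2).
      apply Rmult_le_reg_l with r2; [lra|].
      rewrite <- Rmult_assoc, Rinv_r, Rmult_1_l by lra; apply Hr2. }
    assert (HP : Cmod (Psi (B1 tau) (B2 t)) <=
                 c0 * (Rpower (/ r1) e * Rpower (jap tau) e * (Rpower (/ r2) e * Rpower (jap t) e))).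
    { apply Rle_trans with (1 := HPsi tau t); fold q.
      apply Rmult_le_compat_l; [exact Hc0|].
      replace (- (1 / 4)) with (e + e) by (unfold e; field).
      rewrite Rpower_plus, (Rpower_mult_distr (/ r1)), (Rpower_mult_distr (/ r2)) by assumption.
      apply Rmult_le_compat; try (left; apply Rpower_pos);
        (apply Rpower_le_neg; [nra|assumption|unfold e; lra]). }
    assert (Hinv : / Cmod (B1 tau - z1) <= cz * Rpower (jap tau) (-1)).
    { replace (-1) with (- (1)) by ring.
      rewrite Rpower_Ropp, Rpower_1 by exact Hj1.
      apply Rmult_le_reg_r with (Cmod (B1 tau - z1) * jap tau); [nra|].
      replace (/ Cmod (B1 tau - z1) * (Cmod (B1 tau - z1) * jap tau)) with (jap tau) by (field; lra).
      replace (cz * / jap tau * (Cmod (B1 tau - z1) * jap tau))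
        with (cz * Cmod (B1 tau - z1)) by (field; lra).
      apply Hcz. }
    apply Rle_trans with
      (c0 * (Rpower (/ r1) e * Rpower (jap tau) e * (Rpower (/ r2) e * Rpower (jap t) e))
       * (cz * Rpower (jap tau) (-1)) * cd).
    - apply Rmult_le_compat; [apply Rmult_le_pos|apply Cmod_ge_0| |apply Hcd].
      + apply Cmod_ge_0.
      + left; now apply Rinv_0_lt_compat.
      + apply Rmult_le_compat; [apply Cmod_ge_0| |exact HP|exact Hinv].
        left; now apply Rinv_0_lt_compat.
    - right; replace (- (1) - 1 / 8) with (e + -1) by (unfold e; field).
      replace (-1 - 1 / 8) with (e + -1) by (unfold e; field).
      rewrite Rpower_plus; unfold a; ring. }
  fold e in HI |- *.
  apply Rle_trans with (c1 * (6 / (1 / 8) * (a * Rpower (jap t) e + 0))).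
  - apply Rmult_le_compat_l; [exact Hc1|exact HI].
  - replace (6 / (1 / 8)) with 48 by field; nra.
Qed.

(** Here [P] is the weight at the variable of integration, [Q] that of its distance
    to the real part of the point, [D] the distance to the point and [N] the
    modulus of the point.  The larger of [P] and [D] is at least of order [N]: its
    power [-1/16] is given away for decay in [N], and what remains has total
    exponent [-17/16] and is bounded by that power of the smaller one, where [D]
    can be replaced by [c * Q]. *)
Lemma convolution_weight (P Q D N c : R) :
  0 < c <= 1 -> 1 <= P -> 1 <= Q -> 0 < D -> 0 < N ->
  c * Q <= D -> c * N <= D + P ->
  Rpower P (- (1 / 8)) * / D <=
  Rpower (c / 2) (- (1 / 16)) * Rpower c (- (17 / 16)) * Rpower N (- (1 / 16))
  * (Rpower P (-1 - 1 / 16) + Rpower Q (-1 - 1 / 16)).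
Proof.
  intros Hc HP HQ HD HN HDQ HDN.
  set (b := c / 2); assert (Hb : 0 < b) by (unfold b; lra).
  assert (HbN : b * N * 2 = c * N) by (unfold b; field).
  set (e := - (1 / 16)); set (g := - (17 / 16)).
  replace (-1 - 1 / 16) with g by (unfold g; field).
  rewrite (Rmult_comm (Rpower b e)), (Rmult_assoc (Rpower c g)), Rpower_mult_distr by assumption.
  assert (Hcg : 1 <= Rpower c g).
  { unfold g; rewrite Rpower_Ropp.
    rewrite <- Rinv_1; apply Rinv_le_contravar; [apply Rpower_pos|].
    apply Rle_trans with (Rpower 1 (17 / 16)).
    - apply Rle_Rpower_l; lra.
    - unfold Rpower; rewrite ln_1, Rmult_0_r, exp_0; lra. }
  assert (HbN0 : 0 < b * N) by nra.
  assert (H1 := Rpower_pos (b * N) e); assert (H2 := Rpower_pos P g); assert (H3 := Rpower_pos Q g).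
  assert (HDi : / D = Rpower D (-1)).
  { replace (-1) with (- (1)) by ring; rewrite Rpower_Ropp, Rpower_1; auto. }
  rewrite HDi.
  destruct (Rle_dec P D) as [HPD|HPD].
  - apply Rle_trans with (Rpower (b * N) e * Rpower P g).
    + replace (-1) with (e + - (15 / 16)) by (unfold e; field).
      replace g with (- (1 / 8) + - (15 / 16)) by (unfold g; field).
      rewrite !Rpower_plus.
      rewrite <- Rmult_assoc, (Rmult_comm (Rpower P _)), Rmult_assoc.
      apply Rmult_le_compat; try (left; apply Rpower_pos).
      * left; apply Rmult_lt_0_compat; apply Rpower_pos.
      * apply Rpower_le_neg; unfold e; nra.
      * apply Rmult_le_compat_l; [left; apply Rpower_pos|].
        apply Rpower_le_neg; lra.
    + assert (0 < Rpower (b * N) e * Rpower P g) by (apply Rmult_lt_0_compat; assumption).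
      assert (0 < Rpower (b * N) e * Rpower Q g) by (apply Rmult_lt_0_compat; assumption).
      nra.
  - apply Rle_trans with (Rpower (b * N) e * (Rpower c g * Rpower Q g)).
    + replace (- (1 / 8)) with (e + e) by (unfold e; field).
      rewrite Rpower_plus, Rmult_assoc.
      apply Rmult_le_compat; try (left; apply Rpower_pos).
      * left; apply Rmult_lt_0_compat; apply Rpower_pos.
      * apply Rpower_le_neg; unfold e; nra.
      * rewrite Rpower_mult_distr by lra.
        apply Rle_trans with (Rpower D e * Rpower D (-1)).
        -- apply Rmult_le_compat_r; [left; apply Rpower_pos|].
           apply Rpower_le_neg; unfold e; lra.
        -- rewrite <- Rpower_plus.
           replace (e + -1) with g by (unfold e, g; field).
           apply Rpower_le_neg; unfold g; nra.
    + assert (0 < Rpower c g * Rpower (b * N) e * Rpower P g)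
        by (repeat apply Rmult_lt_0_compat; try assumption; lra).
      nra.
Qed.

Lemma bracket_o_plus_vanishes (A B : contour) (Psi : C -> C -> C) (z1 : C) (c0 : R) :
  height A = 0 -> contour_below B A ->
  (forall t, Cmod (Psi z1 (B t)) <= c0 * Rpower (jap t) (- (1 / 8))) ->
  tends_on (upper A) (fun z2 => bracket_o_plus B Psi z1 z2) 0.
Proof.
  intros Hh HBA HPsi.
  destruct (contour_separation A B Hh HBA) as [c [rho [Hc [Hrho Hsep]]]].
  destruct (path_deriv_bounded B) as [cd [Hcd1 Hcd]].
  assert (Hc0 : 0 <= c0).
  { assert (H := HPsi 0); assert (H' := Cmod_ge_0 (Psi z1 (B 0))).
    assert (Hp := Rpower_pos (jap 0) (- (1 / 8))); nra. }
  pose (c2 := Rpower (c / 2) (- (1 / 16)) * Rpower c (- (17 / 16))).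
  assert (Hc2 : 0 < c2) by (apply Rmult_lt_0_compat; apply Rpower_pos).
  pose (c1 := Cmod (/ (2 * PI * Ci))%C).
  assert (Hc1 : 0 <= c1) by apply Cmod_ge_0.
  pose (c3 := c1 * (192 * (c0 * c2 * cd)) + 1).
  assert (Hc3' : 0 <= c0 * c2 * cd) by (apply Rmult_le_pos; [apply Rmult_le_pos|]; lra).
  assert (Hc3 : 0 < c3) by (unfold c3; nra).
  assert (Hbound : forall z2, upper A z2 -> rho < Cmod z2 ->
            Cmod (bracket_o_plus B Psi z1 z2) <= c3 * Rpower (Cmod z2) (- (1 / 16))).
  { intros z2 Hz2 Hr.
    set (a := c0 * c2 * cd * Rpower (Cmod z2) (- (1 / 16))).
    assert (Hz2p := Rpower_pos (Cmod z2) (- (1 / 16))).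
    assert (Ha : 0 <= a) by (unfold a; nra).
    unfold bracket_o_plus, contour_integral; rewrite Cmod_mult; fold c1.
    assert (HI : Cmod (RInt_gen (V := C_R_CompleteNormedModule)
                (fun t => (Psi z1 (B t) / (B t - z2) * path_deriv B t)%C)
                (Rbar_locally m_infty) (Rbar_locally p_infty))
               <= 6 / (1 / 16) * (a + a)).
    { apply (RInt_gen_jap_decay _ (1 / 16) a a (Re z2)); [lra|assumption|assumption|].
      intros t.
      destruct (Hsep z2 t Hz2 Hr) as [Hs1 Hs2].
      assert (HQ := jap_ge_1 (t - Re z2)); assert (HP := jap_ge_1 t).
      assert (HD : 0 < Cmod (B t - z2)).
      { apply Rlt_le_trans with (2 := Hs1), Rmult_lt_0_compat; lra. }
      rewrite Cmod_mult, Cmod_div by (apply Cmod_gt_0; exact HD).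
      assert (HDi : 0 < / Cmod (B t - z2)) by now apply Rinv_0_lt_compat.
      assert (Hz2m : 0 < Cmod z2) by lra.
      assert (Hw := convolution_weight (jap t) (jap (t - Re z2)) (Cmod (B t - z2)) (Cmod z2) c
               Hc HP HQ HD Hz2m Hs1 Hs2).
      apply Rle_trans with (c0 * Rpower (jap t) (- (1 / 8)) * / Cmod (B t - z2) * cd).
      - apply Rmult_le_compat; [|apply Cmod_ge_0| |apply Hcd].
        + apply Rmult_le_pos; [apply Cmod_ge_0|lra].
        + apply Rmult_le_compat_r; [lra|apply HPsi].
      - fold c2 in Hw.
        replace (c0 * Rpower (jap t) (- (1 / 8)) * / Cmod (B t - z2) * cd)
          with (c0 * cd * (Rpower (jap t) (- (1 / 8)) * / Cmod (B t - z2))) by ring.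
        replace (a * _ + a * _) with
          (c0 * cd * (c2 * Rpower (Cmod z2) (- (1 / 16))
            * (Rpower (jap t) (-1 - 1 / 16) + Rpower (jap (t - Re z2)) (-1 - 1 / 16))))
          by (unfold a; ring).
        apply Rmult_le_compat_l; [nra|exact Hw]. }
    apply Rle_trans with (c1 * (6 / (1 / 16) * (a + a))).
    - apply Rmult_le_compat_l; [exact Hc1|exact HI].
    - unfold c3; replace (6 / (1 / 16) * (a + a)) with (192 * a) by field.
      unfold a; nra. }
  intros P [e He].
  (* The radius beyond which [c3 * Cmod z2 ^ (- 1/16) < e]. *)
  pose (r := Rpower (c3 / e) 16).
  assert (Hep := cond_pos e).
  exists (Rmax rho r); intros z2 Hr Hz2.
  assert (Hr1 : rho < Cmod z2) by (apply Rle_lt_trans with (2 := Hr); apply Rmax_l).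
  assert (Hr2 : r < Cmod z2) by (apply Rle_lt_trans with (2 := Hr); apply Rmax_r).
  assert (Hlt : Cmod (bracket_o_plus B Psi z1 z2) < e).
  { apply Rle_lt_trans with (1 := Hbound z2 Hz2 Hr1).
    assert (Hce : 0 < c3 / e) by (apply Rdiv_lt_0_compat; assumption).
    assert (H16 : c3 / e < Rpower (Cmod z2) (1 / 16)).
    { rewrite <- (Rpower_1 (c3 / e)) by exact Hce.
      replace 1 with (16 * (1 / 16)) at 1 by field.
      rewrite <- Rpower_mult; fold r.
      apply Rlt_Rpower_l; [lra|split; [apply Rpower_pos|exact Hr2]]. }
    rewrite Rpower_Ropp.
    assert (Hp := Rpower_pos (Cmod z2) (1 / 16)).
    apply Rmult_lt_reg_r with (Rpower (Cmod z2) (1 / 16)); [exact Hp|].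
    rewrite Rmult_assoc, Rinv_l, Rmult_1_r by lra.
    apply (Rmult_lt_compat_l e) in H16; [|exact Hep].
    replace (e * (c3 / e)) with c3 in H16 by (field; lra); exact H16. }
  apply He.
  set (v := bracket_o_plus B Psi z1 z2) in *.
  split.
  - change (Rabs (Re v - 0) < e); rewrite Rminus_0_r.
    apply Rle_lt_trans with (2 := Hlt), re_le_Cmod.
  - change (Rabs (Im v - 0) < e); rewrite Rminus_0_r.
    apply Rle_lt_trans with (2 := Hlt), Im_le_Cmod.
Qed.

(** * Conclusion *)

Lemma on_band (A B : contour) (t : R) : contour_below B A -> band B A (B t).
Proof.
  intros [_ [H _]]; split.
  - apply (sides_meet B); now exists t.
  - apply H.
Qed.

Lemma Cmod_root_le (k : R) (s w : C) :
  0 < k -> (s ^ 2 = k ^ 2 - w ^ 2)%C -> Cmod s <= k + Cmod w.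
Proof.
  intros Hk Hs.
  assert (Hw := Cmod_ge_0 w).
  apply Rsqr_incr_0_var; [|lra].
  rewrite !Rsqr_pow2, <- Cmod_pow, Hs.
  apply Rle_trans with (1 := Cmod_triangle _ _).
  rewrite Cmod_opp, !Cmod_pow, Cmod_R, Rabs_pos_eq by lra; nra.
Qed.

Lemma div_kernel_decay (Phi S : C) (q c0 c1 : R) :
  1 <= q -> 0 <= c1 -> S <> 0 ->
  Cmod S <= c1 * q ->
  Cmod Phi <= c0 * Rpower q (- (3 / 4)) ->
  Cmod (Phi / (1 / Csqrt_down S)) <= c0 * sqrt c1 * Rpower q (- (1 / 4)).
Proof.
  intros Hq Hc1 HS0 HS HPhi.
  assert (HR : Csqrt_down S <> 0).
  { apply Cmod_gt_0; rewrite Cmod_Csqrt_down; apply sqrt_lt_R0, Cmod_gt_0, HS0. }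
  replace (Phi / (1 / Csqrt_down S))%C with (Phi * Csqrt_down S)%C
    by (field; exact HR).
  rewrite Cmod_mult, Cmod_Csqrt_down.
  replace (- (1 / 4)) with (- (3 / 4) + / 2) by field.
  rewrite Rpower_plus, Rpower_sqrt by lra.
  replace (c0 * sqrt c1 * (Rpower q (- (3 / 4)) * sqrt q))
    with (c0 * Rpower q (- (3 / 4)) * sqrt (c1 * q)) by (rewrite sqrt_mult by lra; ring).
  apply Rmult_le_compat; [apply Cmod_ge_0|apply sqrt_pos|exact HPhi|].
  now apply sqrt_le_1_alt.
Qed.

Theorem mainTheorem5
  (k M eps : R) (a1 : C)
  (A1 A2 B1 B2 : contour)
  (Hk : 0 < k) (HM : 0 < M)
  (HA1 : height A1 = 0) (HA2 : height A2 = 0)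
  (HA1k : strictly_below A1 (- k)%C /\ strictly_above A1 k)
  (HA2k : strictly_below A2 (- k)%C /\ strictly_above A2 k)
  (HM1 : forall z, upper A1 z -> - M <= Im z)
  (HM2 : forall z, lower A2 z -> Im z <= M)
  (Ha1 : lower A1 a1)
  (* the eigenfunction *)
  (l1 nu beta : R) (u : R3 -> R)
  (Hu : first_eigenfunction l1 u)
  (Hnu : nu = sqrt (l1 + 1 / 4))
  (Hf : equatorial_trace (spherical u (PI / 2)) beta)
  (* the kernel factors *)
  (K Kpp Kpm Kmp Kmm : C -> C -> C) (s : C -> C)
  (HK : kernel k A1 A2 K)
  (Hfact : forall z1 z2, on A1 z1 -> on A2 z2 ->
     (K z1 z2 = Kpp z1 z2 * Kpm z1 z2 * Kmp z1 z2 * Kmm z1 z2)%C)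
  (HKpp : kernel_factor (upper A1) (upper A2) Kpp)
  (HKpm : kernel_factor (upper A1) (lower A2) Kpm)
  (HKmp : kernel_factor (lower A1) (upper A2) Kmp)
  (HKmm : kernel_factor (lower A1) (lower A2) Kmm)
  (HKO : forall z1, upper A1 z1 ->
     bigO_on (on A2) (fun z2 => (Kmp a1 z2 / Kpm z1 z2)%C) (fun _ => 1))
  (Hs : inner_root k A1 A2 B2 s)
  (HKmo : forall z1 z2, lower A1 z1 -> band B2 A2 z2 ->
     (K_mo Kmp Kmm z1 z2 = 1 / Csqrt_down (s z2 - z1))%C)
  (* B1 lies just below A1: I_pm is still analytic in z1 down to B1 *)
  (HB1 : contour_below B1 A1)
  (HB1eps : forall t, - (eps - M) < Im (B1 t))
  (* B2 lies just below A2: what is known on A2 persists down to B2 *)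
  (HB2 : contour_below B2 A2)
  (HB2an : analytic_on (rect (lower A1) (band B2 A2)) Kmp)
  (HB2O : forall z1, upper A1 z1 ->
     bigO_on (on B2) (fun z2 => (Kmp a1 z2 / Kpm z1 z2)%C) (fun _ => 1)) :
  2 * M < eps ->
  forall z1, upper A1 z1 ->
    tends_on (upper A2)
      (fun z2 => I_op B1 B2 a1 Kpm Kmp Kmm (I_pm (spherical u) nu eps) z1 z2) 0.
Proof.
  intros Heps z1 Hz1.
  assert (Hnu0 : 0 <= nu) by (rewrite Hnu; apply sqrt_pos).
  assert (HB1low : forall t, strictly_below A1 (B1 t)) by apply HB1.
  assert (HB2low : forall t, strictly_below A2 (B2 t)) by apply HB2.
  assert (HB2band : forall t, band B2 A2 (B2 t)) by (intros t; now apply on_band).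
  destruct Hs as [Hs2 [_ [_ [_ Hsup]]]].
  destruct (quotient_bounded B2 (Kmp a1) (Kpm z1)) as [cr [Hcr1 Hcr]].
  { apply (analytic_on_continuous _ _ B2 a1 HB2an); intros t; now split. }
  { apply (analytic_on_continuous _ _ B2 z1 (proj1 HKpm)); intros t; split;
      [exact Hz1|apply HB2low]. }
  { intros t; apply (proj1 (proj2 HKpm)); [exact Hz1|apply HB2low]. }
  { exact (HB2O z1 Hz1). }
  destruct (contour_Im_bounded B1) as [i1 [Hi10 Hi1]].
  destruct (contour_Im_bounded B2) as [i2 [Hi20 Hi2]].
  destruct (bracket_plus_o_decay B1 B2
              (fun w1 w2 => I_pm (spherical u) nu eps w1 w2 / K_mo Kmp Kmm w1 w2)%C z1
              (Rpower (Rmin (M / 2) 1) (- (nu + 3 / 2)) * (8 + 4 * PI)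
               * sqrt (k + i1 + i2 + 2))) as [cJ [HcJ1 HcJ]].
  { intros t H; apply (HB1low t); now rewrite H. }
  { intros tau t.
    rewrite HKmo by (apply HB1low || apply HB2band).
    set (q := sqrt (1 + Re (B1 tau) ^ 2 + Re (B2 t) ^ 2)).
    assert (Hq0 : q ^ 2 = 1 + Re (B1 tau) ^ 2 + Re (B2 t) ^ 2)
      by (unfold q; rewrite pow2_sqrt; nra).
    assert (Hqp : 0 <= q) by apply sqrt_pos.
    assert (Hq1 : 1 <= q) by (apply Rsqr_incr_0_var; [unfold Rsqr; nra|exact Hqp]).
    assert (Hqx : Rabs (Re (B1 tau)) <= q).
    { rewrite <- (Rabs_pos_eq q Hqp); apply Rsqr_le_abs_0; unfold Rsqr; nra. }
    assert (Hqy : Rabs (Re (B2 t)) <= q).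
    { rewrite <- (Rabs_pos_eq q Hqp); apply Rsqr_le_abs_0; unfold Rsqr; nra. }
    apply div_kernel_decay; [exact Hq1|lra| | |].
    - intros H.
      destruct (Hsup (B2 t) 0 (HB2band t) (Rle_refl 0)) as [_ Hnl]; apply Hnl.
      replace (s (B2 t) + Ci * 0)%C with (s (B2 t) - B1 tau + B1 tau)%C by ring.
      rewrite H, Cplus_0_l; apply HB1low.
    - apply Rle_trans with (1 := Cmod_triangle _ _); rewrite Cmod_opp.
      assert (H1 := Cmod_root_le k _ _ Hk (Hs2 _ (HB2band t))).
      assert (H2 := Cmod_le_Rabs (B1 tau)); assert (H3 := Cmod_le_Rabs (B2 t)).
      assert (H4 := Hi1 tau); assert (H5 := Hi2 t).
      nra.
    - apply I_pm_decay; auto.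
      + intros phi Hphi; now apply equatorial_trace_le_1 with beta.
      + left; apply HB1eps.
      + apply HM2, HB2low. }
  unfold I_op.
  apply (bracket_o_plus_vanishes A2 B2 _ z1 (cr * cJ) HA2 HB2).
  intros t; cbv beta; rewrite Cmod_mult, Rmult_assoc.
  apply Rmult_le_compat; try apply Cmod_ge_0; [apply Hcr|apply HcJ].
Qed.
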